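(* Let $W\in\mathbb{R}^{m\times d}$, $K\in\mathbb{R}^{d\times r}$, $V\in\mathbb{R}^{m\times r}$, and let $P\in\mathbb{R}^{d\times d}$ be an orthogonal projector. Put $R = V - WK$. If $\Delta\in\mathbb{R}^{m\times d}$ is a solution of the optimization problem $$\min_{\Delta\in\mathbb{R}^{m\times d}} \;\|(W+\Delta P)K - V\|^2 + \|\Delta P\|^2,$$ then $$\Delta P \;=\; R K^\top P\,\big(KK^\top P + I_d\big)^{-1} \;=\; R\,\big(K^\top P K + I_r\big)^{-1}K^\top P .$$
   Context: $\|\cdot\|$ is the Frobenius norm on matrices; an orthogonal projector is a matrix $P$ with $P=P^\top=P^2$; $I_n$ is the $n\times n$ identity matrix. *)

(* Defs.v *)
From HB Require Import structures.
From mathcomp Require Import all_boot all_order all_algebra.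
From mathcomp Require Import reals.

Set Implicit Arguments.
Unset Strict Implicit.
Unset Printing Implicit Defensive.

Import Order.TTheory GRing.Theory Num.Theory.
Local Open Scope ring_scope.

(* MathComp-Analysis's norm `|A| on matrices is the max norm, so the Frobenius
   norm is defined here. *)
Definition frobenius_norm (R : rcfType) (m n : nat) (A : 'M[R]_(m, n)) : R :=
  Num.sqrt (\sum_(i < m) \sum_(j < n) A i j ^+ 2).

Definition orthogonal_projector (R : rcfType) (n : nat) (P : 'M[R]_n) : Prop :=
  P = P^T /\ P = P *m P.

Definition objective (R : rcfType) (m d r : nat)
    (W : 'M[R]_(m, d)) (K : 'M[R]_(d, r)) (V : 'M[R]_(m, r)) (P : 'M[R]_d)
    (Delta : 'M[R]_(m, d)) : R :=
  frobenius_norm ((W + Delta *m P) *m K - V) ^+ 2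
  + frobenius_norm (Delta *m P) ^+ 2.

Definition is_minimizer (R : rcfType) (T : Type) (f : T -> R) (x : T) : Prop :=
  forall y : T, f x <= f y.

(* Main.v *)
Require Import Defs.
From HB Require Import structures.
From mathcomp Require Import all_boot all_order all_algebra.
From mathcomp Require Import reals.
From mathcomp Require Import ring lra.

Set Implicit Arguments.
Unset Strict Implicit.
Unset Printing Implicit Defensive.

Import Order.TTheory GRing.Theory Num.Theory.
Local Open Scope ring_scope.

(** Stationarity of the quadratic objective at [Delta], tested in the direction
    of its own gradient, gives [X (K K^T P + 1) = Res K^T P] for [X = Delta P].
    The matrix [K^T P K + 1 = (P K)^T (P K) + 1] is positive definite, hence
    invertible; Woodbury's identity transfers invertibility to [K K^T P + 1],
    and the push-through identity
    [(K^T P K + 1) K^T P = K^T P (K K^T P + 1)] yields the second formula. *)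

Lemma frobenius_norm_sqr (R : rcfType) (m n : nat) (A : 'M[R]_(m, n)) :
  frobenius_norm A ^+ 2 = \tr (A *m A^T).
Proof.
rewrite sqr_sqrtr; last first.
  by apply: sumr_ge0 => i _; apply: sumr_ge0 => j _; apply: sqr_ge0.
apply: eq_bigr => i _; rewrite mxE; apply: eq_bigr => j _.
by rewrite mxE expr2.
Qed.

Lemma mxtrace_mul_tr_ge0 (R : rcfType) (m n : nat) (A : 'M[R]_(m, n)) :
  0 <= \tr (A *m A^T).
Proof. by rewrite -frobenius_norm_sqr sqr_ge0. Qed.

Lemma mxtrace_mul_tr_eq0 (R : realDomainType) (m n : nat) (A : 'M[R]_(m, n)) :
  \tr (A *m A^T) = 0 -> A = 0.
Proof.
move=> trA0; apply/matrixP => i j; rewrite mxE.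
have ge0 k : 0 <= (A *m A^T) k k.
  by rewrite mxE; apply: sumr_ge0 => l _; rewrite mxE -expr2 sqr_ge0.
have /(_ i isT) := psumr_eq0P (fun k (_ : xpredT k) => ge0 k) trA0.
rewrite mxE => /psumr_eq0P-/(_ _ j isT); rewrite mxE -expr2 => Aij0.
apply/eqP; rewrite -sqrf_eq0 Aij0 // => l _.
by rewrite mxE -expr2 sqr_ge0.
Qed.

Lemma mxtrace_mul_trC (R : comNzRingType) (m n : nat) (A B : 'M[R]_(m, n)) :
  \tr (A *m B^T) = \tr (B *m A^T).
Proof. by rewrite -mxtrace_tr trmx_mul trmxK. Qed.

Lemma mxtrace_sqrD (R : comNzRingType) (m n : nat) (A B : 'M[R]_(m, n)) (t : R) :
  \tr ((A + t *: B) *m (A + t *: B)^T) =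
  \tr (A *m A^T) + t * (2 * \tr (A *m B^T)) + t ^+ 2 * \tr (B *m B^T).
Proof.
rewrite linearD /= linearZ /= mulmxDl !mulmxDr -!scalemxAl -!scalemxAr.
rewrite !mxtraceD !mxtraceZ (mxtrace_mul_trC B A); ring.
Qed.

(** At [t = - b / (1 + c)] the expression equals [- (b / (1 + c)) ^+ 2], which is nonnegative only
    if [b = 0]. The denominator [1 + c] stays positive even when [c = 0]. *)
Lemma linear_coef_eq0 (R : realFieldType) (b c : R) :
  0 <= c -> (forall t, 0 <= t * b + t ^+ 2 * c) -> b = 0.
Proof.
move=> c0 /(_ (- b / (1 + c))) ge0.
have c1 : 0 < 1 + c by lra.
have E : - b / (1 + c) * b + (- b / (1 + c)) ^+ 2 * c = - (b / (1 + c)) ^+ 2.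
  by field; rewrite gt_eqF.
move: ge0; rewrite E oppr_ge0 => le0.
have /eqP : (b / (1 + c)) ^+ 2 = 0 by apply/eqP; rewrite eq_le le0 sqr_ge0.
by rewrite sqrf_eq0 mulf_eq0 invr_eq0 (gt_eqF c1) orbF => /eqP.
Qed.

(** A row [v] in the left kernel satisfies $\|vA^\top\|^2 + \|v\|^2 = 0$, as multiplying by [v^T] on
    the right shows; hence [v = 0]. *)
Lemma gram_add1_unitmx (R : rcfType) (m n : nat) (A : 'M[R]_(m, n)) :
  A^T *m A + 1%:M \in unitmx.
Proof.
rewrite -row_free_unit; apply/inj_row_free => v vA0.
apply: mxtrace_mul_tr_eq0; apply/eqP; rewrite eq_le mxtrace_mul_tr_ge0 andbT.
have : \tr (v *m (A^T *m A + 1%:M) *m v^T) = 0 by rewrite vA0 mul0mx mxtrace0.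
rewrite mulmxDr mulmx1 mulmxDl mxtraceD => E.
have := mxtrace_mul_tr_ge0 (v *m A^T).
rewrite trmx_mul trmxK -!mulmxA in E *; lra.
Qed.

Lemma mulmx_add1_unitmxC (R : comUnitRingType) (m n : nat)
    (A : 'M[R]_(m, n)) (B : 'M[R]_(n, m)) :
  B *m A + 1%:M \in unitmx -> A *m B + 1%:M \in unitmx.
Proof.
move=> uBA.
(* Woodbury's candidate for the inverse; for square matrices a right inverse suffices. *)
have : (A *m B + 1%:M) *m (1%:M - A *m invmx (B *m A + 1%:M) *m B) = 1%:M.
  have E : (A *m B + 1%:M) *m A = A *m (B *m A + 1%:M).
    by rewrite mulmxDl mulmxDr mulmxA mul1mx mulmx1.
  by rewrite mulmxBr mulmx1 !mulmxA E mulmxK // addrAC subrr add0r.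
by case/mulmx1_unit.
Qed.

Lemma minimizer_normal_equation (R : rcfType) (m d r : nat)
    (W : 'M[R]_(m, d)) (K : 'M[R]_(d, r)) (V : 'M[R]_(m, r)) (P : 'M[R]_d)
    (Delta : 'M[R]_(m, d)) :
  orthogonal_projector P -> is_minimizer (objective W K V P) Delta ->
  Delta *m P *m (K *m K^T *m P + 1%:M) = (V - W *m K) *m K^T *m P.
Proof.
move=> [Psym Pidem] minD.
set Y := (W + Delta *m P) *m K - V; set X := Delta *m P.
(* [G] is half the gradient of the objective at [Delta]. Since [V - W *m K = X *m K - Y], the
   claimed equation rearranges to [G = 0]. *)
pose G := Y *m K^T *m P + X.
suff G0 : G = 0.
  have resE : V - W *m K = X *m K - Y.
    by rewrite /Y mulmxDl opprB addrCA (addrC (W *m K)) opprD addNKr.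
  rewrite resE !mulmxBl mulmxDr mulmx1 !mulmxA; apply/eqP.
  by rewrite (inj_eq (addrI _)) -addr_eq0 addrC -!mulmxBl -/Y -/G G0.
apply: mxtrace_mul_tr_eq0.
(* Along [Delta + t *: G] the objective is quadratic in [t]: [c] is its leading coefficient, and by
   [gradE] its linear coefficient is $2\|G\|^2$. *)
pose c := \tr (G *m P *m K *m (G *m P *m K)^T) + \tr (G *m P *m (G *m P)^T).
have gradE : \tr (Y *m (G *m P *m K)^T) + \tr (X *m (G *m P)^T) = \tr (G *m G^T).
  rewrite !trmx_mul -Psym !mulmxA -mxtraceD -mulmxDl /X -(mulmxA Delta P P).
  by rewrite -Pidem.
have c0 : 0 <= c by rewrite addr_ge0 ?mxtrace_mul_tr_ge0.
suff : 2 * \tr (G *m G^T) = 0 by lra.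
apply: (linear_coef_eq0 c0) => t.
have := minD (Delta + t *: G).
have -> : objective W K V P (Delta + t *: G) =
    \tr ((Y + t *: (G *m P *m K)) *m (Y + t *: (G *m P *m K))^T) +
    \tr ((X + t *: (G *m P)) *m (X + t *: (G *m P))^T).
  rewrite /objective !frobenius_norm_sqr.
  rewrite (mulmxDl Delta) -scalemxAl addrA (mulmxDl (W + _)) -scalemxAl.
  by rewrite [_ + _ - V]addrAC.
rewrite /objective !frobenius_norm_sqr -/X -/Y !mxtrace_sqrD -gradE /c.
lra.
Qed.

(* invmx is total (the identity on singular matrices), so the existence of the
   two inverses is asserted explicitly. *)
Theorem mainTheorem4 (R : realType) (m d r : nat)
    (W : 'M[R]_(m, d)) (K : 'M[R]_(d, r)) (V : 'M[R]_(m, r)) (P : 'M[R]_d)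
    (hP : orthogonal_projector P)
    (Delta : 'M[R]_(m, d))
    (hDelta : is_minimizer (objective W K V P) Delta) :
  let Res : 'M[R]_(m, r) := V - W *m K in
  [/\ K *m K^T *m P + 1%:M \in unitmx,
      K^T *m P *m K + 1%:M \in unitmx,
      Delta *m P = Res *m K^T *m P *m invmx (K *m K^T *m P + 1%:M) &
      Delta *m P = Res *m invmx (K^T *m P *m K + 1%:M) *m K^T *m P].
Proof.
move=> Res; have [Psym Pidem] := hP.
have uB : K^T *m P *m K + 1%:M \in unitmx.
  (* $P = P^\top P$ exhibits $K^\top P K$ as the Gram matrix of $PK$. *)
  have -> : K^T *m P *m K = (P *m K)^T *m (P *m K).
    by rewrite trmx_mul -Psym -!mulmxA (mulmxA P P) -Pidem.
  exact: gram_add1_unitmx.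
have uA : K *m K^T *m P + 1%:M \in unitmx.
  by rewrite -mulmxA; apply: mulmx_add1_unitmxC.
have normal := minimizer_normal_equation hP hDelta; rewrite -/Res in normal.
(* Both formulas are checked after right multiplication by the invertible $KK^\top P + I$, where the
   left side is given by [normal]. *)
split=> //; apply: (can_inj (mulmxK uA)); rewrite normal; first by rewrite mulmxKV.
have push : K^T *m P *m (K *m K^T *m P + 1%:M) =
    (K^T *m P *m K + 1%:M) *m (K^T *m P).
  by rewrite mulmxDr mulmxDl mulmx1 mul1mx !mulmxA.
by rewrite -(mulmxA _ K^T P) -(mulmxA _ (K^T *m P)) push !mulmxA mulmxKV.
Qed.
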